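(* Let $G$ be a finite group of order $n$. Let $\rho_1,\dots,\rho_k$ be pairwise non-isomorphic irreducible representations of $G$ with $d_j=\dim\rho_j$, let $a_1,\dots,a_k\ge0$ be integers with $a_1+\cdots+a_k=n$, and let $\rho$ be an irreducible representation of $G^n$ which is a tensor product of $n$ factors among which $\rho_j$ occurs exactly $a_j$ times for each $j$ (denoted $\rho=\rho_1^{a_1}\otimes\cdots\otimes\rho_k^{a_k}$ up to order of factors). Then \[ \binom{n}{a_1,\dots,a_k}\|\widehat{1_S}(\rho)\|_{\mathrm{HS}}^2\dim\rho\le\frac{n!}{n^n}\prod_{j=1}^k\frac{(a_j+d_j^2-1)!}{a_j^{a_j}(d_j^2-1)!}. \]
   Context: Representations are finite-dimensional unitary complex. Irreducible representations of $G^n$ are $\rho=\sigma_1\otimes\cdots\otimes\sigma_n$ with $\sigma_i$ irreducible representations of $G$, acting by $\rho(g_1,\dots,g_n)=\sigma_1(g_1)\otimes\cdots\otimes\sigma_n(g_n)$. $S\subset G^n$ is the set of $n$-tuples with pairwise distinct entries and $\widehat{1_S}(\rho)=n^{-n}\sum_{x\in S}\rho(x)$. $\|R\|_{\mathrm{HS}}=(\operatorname{tr}RR^* )^{1/2}$ is the Hilbert--Schmidt norm. Convention $0^0=1$. *)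

(* Defs.v *)
From mathcomp Require Import all_boot all_order all_fingroup all_algebra.
From mathcomp Require Import all_character complex reals.

Set Implicit Arguments.
Unset Strict Implicit.
Unset Printing Implicit Defensive.

Import Order.TTheory GRing.Theory Num.Theory.
Local Open Scope ring_scope.

(* MathComp puts the componentwise group law on {dffun ...}; on {ffun ...}
   there is no group structure. *)
Notation grp_pow gT n := {dffun forall _ : 'I_n, gT}.

Section TensorProduct.

Variables (F : fieldType) (n : nat) (d : 'I_n -> nat).

(* A row or column number u of the n-fold Kronecker product encodes a
   multi-index (u_0, ..., u_(n-1)) with u_i < d i; the size of the product is
   thus \prod_i d i. *)
Definition multi_index (u : 'I_#|{dffun forall i, 'I_(d i)}|) (i : 'I_n) :
    'I_(d i) :=
  (enum_val u : {dffun forall i, 'I_(d i)}) i.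

Variables (gT : finGroupType).
Variable sigma : forall i, mx_representation F [set: gT]%G (d i).

Definition tensor_mx (x : grp_pow gT n) :
    'M[F]_#|{dffun forall i, 'I_(d i)}| :=
  \matrix_(u, v) \prod_i sigma i (x i) (multi_index u i) (multi_index v i).

Lemma tensor_mx_repr : mx_repr [set: grp_pow gT n]%G tensor_mx.
Proof.
split=> [|x y _ _]; apply/matrixP=> u v; rewrite !mxE.
  rewrite (eq_bigr (fun i => (multi_index u i == multi_index v i)%:R)).
    have [->|neq_uv] := eqVneq u v; first by apply: big1 => i _; rewrite eqxx.
    have /existsP[i /negPf neq_i] :
        [exists i, multi_index u i != multi_index v i].
      rewrite -negb_forall; apply: contra neq_uv => /forallP eq_uv.
      by apply/eqP/enum_val_inj/ffunP=> i; apply/eqP/eq_uv.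
    by rewrite (bigD1 i) //= neq_i mul0r.
  by move=> i _; rewrite ffunE repr_mx1 mxE.
rewrite (eq_bigr (fun i => \sum_(j < d i) sigma i (x i) (multi_index u i) j *
                                     sigma i (y i) j (multi_index v i))).
  pose f i := [ffun j : 'I_(d i) => sigma i (x i) (multi_index u i) j *
                                    sigma i (y i) j (multi_index v i)].
  transitivity (\prod_i \sum_(j < d i) f i j).
    by apply: eq_bigr => i _; apply: eq_bigr => j _; rewrite ffunE.
  under eq_bigr do rewrite (big_tag (fun i j => f i j)).
  rewrite bigA_distr_big_dep -big_fprod.
  rewrite (reindex _ (onW_bij _ (fprod_of_dffun_bij _))).
  rewrite (reindex _ (onW_bij _ (enum_val_bij _))).
  apply: eq_bigr => w _; rewrite !mxE -big_split.
  by apply: eq_bigr => i _; rewrite fprodE ffunE.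
by move=> i _; rewrite ffunE repr_mxM ?inE // mxE.
Qed.

Definition tensor_repr := MxRepresentation tensor_mx_repr.

End TensorProduct.

Section Fourier.

Variables (C : numClosedFieldType) (gT : finGroupType) (n : nat).

Definition distinct_tuples : {set grp_pow gT n} :=
  [set x : grp_pow gT n | injectiveb (fun i => x i)].

(* The normalisation is that of the uniform measure on G^n for #|G| = n. *)
Definition hat_1S (D : nat)
    (rho : mx_representation C [set: grp_pow gT n]%G D) : 'M[C]_D :=
  (n ^ n)%:R^-1 *: \sum_(x in distinct_tuples) rho x.

End Fourier.

Definition unitary_repr (C : numClosedFieldType) (gT : finGroupType)
    (G : {group gT}) (D : nat) (rho : mx_representation C G D) : Prop :=
  forall g, g \in G -> rho g \is unitarymx.

Definition HS_norm (C : numClosedFieldType) (D : nat) (A : 'M[C]_D) : C :=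
  sqrtC (\tr (A *m map_mx Num.conj A^T)).

Definition multinomial (n k : nat) (a : 'I_k -> nat) : nat :=
  (n`! %/ \prod_(j < k) (a j)`!)%N.

(* Main.v *)
(** Index the matrix coefficients of rho_1, ..., rho_k by the disjoint union K of
the blocks {1..d_j}^2, list G as g_1, ..., g_n, and let
P(t) = prod_i (sum_x t_x M_x(g_i)), a form of degree n in the variables t_x, x in K.
The entries of sum_(x in S) rho(x) are the symmetrized coefficients m! [t^m] P for
exponents m of block degree (a_1, ..., a_k), so that, up to explicit factors,
||hat 1_S(rho)||^2 is the sum of m! |[t^m] P|^2 over these m.

By Schur orthogonality and AM-GM, |P(t)|^2 <= (sum_j s_j / d_j)^n whenever
|t|^2 has mass s_j on block j. Averaging |P|^2 over the phases of t kills the cross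
terms, and averaging then over the simplex of vectors |t|^2 in each block produces
the weights m! and the factors (a_j + d_j^2 - 1)! / (d_j^2 - 1)!. The choice
s_j = d_j a_j gives the theorem. Both averages are made discrete: roots of unity
for the phases, compositions of a large integer M for the simplex. *)

Require Import Defs.
From mathcomp Require Import all_boot all_order all_fingroup all_algebra.
From mathcomp Require Import all_character complex reals.
From mathcomp Require Import cyclic separable cyclotomic.
From mathcomp Require Import zify ring.
Import Order.TTheory GRing.Theory Num.Theory.
Local Open Scope ring_scope.

Set Implicit Arguments.
Unset Strict Implicit.
Unset Printing Implicit Defensive.

(** * Moments of the simplex *)

(** Sort the subsets of [{0, ..., L}] with [m + q + 1] elements by their [m + 1]-st smallest element
    [i]: [m] elements lie below it and [q] above. *)
Lemma sum_bin_conv (m q L : nat) :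
  (\sum_(0 <= i < L.+1) 'C(i, m) * 'C(L - i, q) = 'C(L.+1, (m + q).+1))%N.
Proof.
elim: L m => [|L IHL] m.
  by rewrite big_nat1 subnn; case: m => [|m]; case: q => [|q]; rewrite // ?bin0n.
case: m => [|m].
  rewrite big_nat_recl // bin0 mul1n subn0 binS addnC; congr (_ + _)%N.
  by rewrite -(IHL 0%N); apply: eq_bigr => i _; rewrite !bin0 subSS.
rewrite big_nat_recl // bin0n mul0n add0n binS.
rewrite -(IHL m.+1) [in X in (_ + X)%N]addSn -(IHL m) -big_split /=.
by apply: eq_bigr => i _; rewrite subSS binS mulnDl.
Qed.

Lemma sum_bin_conv_shift (m q M p : nat) :
  (\sum_(0 <= i < M.+1) 'C(i, m) * 'C(M - i + p, q + p)
     = 'C(M + p.+1, m + q + p.+1))%N.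
Proof.
rewrite !addnS -addnA -(sum_bin_conv m (q + p) (M + p)).
(* The full convolution runs up to [M + p]; its terms with [i > M] vanish, since then
   [M + p - i < p]. *)
rewrite [RHS](big_cat_nat (n := M.+1)) ?ltnS ?leq_addr //=.
rewrite [X in _ = (_ + X)%N]big_nat_cond [X in _ = (_ + X)%N]big1 ?addn0; last first.
  move=> i /andP[/andP[lt_Mi le_i] _].
  by rewrite ['C(_, q + p)]bin_small ?muln0 //; lia.
by apply: eq_big_nat => i /andP[_]; rewrite ltnS => le_iM; rewrite addnBAC.
Qed.

Section Compositions.

Variable T : eqType.

(** Weak compositions of [M] with parts indexed by [s], as functions that are zero off [s]. A list
    built one part at a time suits induction on [s]. *)
Fixpoint compositions (s : seq T) (M : nat) : seq (T -> nat) :=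
  if s is x :: s' then
    [seq (fun y => if y == x then i else v y) | i <- iota 0 M.+1,
                                                v <- compositions s' (M - i)]
  else if M is 0 then [:: fun=> 0%N] else [::].

Lemma all_compositions (s : seq T) (M : nat) : uniq s ->
  all (fun v => \sum_(x <- s) v x == M)%N (compositions s M).
Proof.
elim: s M => [|x s IHs] M; first by case: M => //=; rewrite big_nil.
rewrite cons_uniq => /andP[s'x Us]; rewrite /compositions -/compositions.
have: all (geq M) (iota 0 M.+1).
  by apply/allP=> i; rewrite mem_iota ltnS.
elim: (iota 0 M.+1) => // i r IHr /=; rewrite all_cat => /andP[le_iM /IHr->].
rewrite andbT all_map.
apply: sub_all (IHs (M - i)%N Us) => v /= /eqP sum_v.
rewrite big_cons eqxx big_seq (eq_bigr v) -?big_seq ?sum_v ?subnKC //.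
by move=> y s_y; case: eqP s'x => // <-; rewrite s_y.
Qed.

(** A discrete Dirichlet integral, with binomials in place of powers: splitting off the first part
    gives a convolution of binomials. The index list is written [x :: s] because [size s] is the
    dimension of the simplex. *)
Lemma sum_compositions_bin (x : T) (s : seq T) (m : T -> nat) (M : nat) :
  uniq (x :: s) ->
  (\sum_(v <- compositions (x :: s) M) \prod_(y <- x :: s) 'C(v y, m y)
    = 'C(M + size s, \sum_(y <- x :: s) m y + size s))%N.
Proof.
have step z t L : z \notin t ->
    (\sum_(v <- compositions (z :: t) L) \prod_(y <- z :: t) 'C(v y, m y) =
     \sum_(0 <= i < L.+1) 'C(i, m z) *
        \sum_(v <- compositions t (L - i)) \prod_(y <- t) 'C(v y, m y))%N.
  move=> t'z; rewrite big_allpairs_dep /index_iota subn0.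
  apply: eq_bigr => i _; rewrite big_distrr; apply: eq_bigr => v _ /=.
  rewrite big_cons eqxx; congr (_ * _)%N; rewrite [LHS]big_seq [RHS]big_seq.
  by apply: eq_bigr => y t_y; case: eqP t'z => // <-; rewrite t_y.
elim: s x M => [|z s IHs] x M.
  (* With a single index only [i = M] contributes: a positive remainder [M - i] has no composition
     into zero parts. *)
  move=> _; rewrite step // big_nat_recr //= subnn big_nat_cond big1.
    by rewrite !big_seq1 big_nil muln1 !addn0.
  move=> i /andP[/andP[_ lt_iM] _].
  by case: (M - i)%N (subn_gt0 i M) => [|k]; rewrite ?lt_iM // big_nil muln0.
rewrite cons_uniq => /andP[s'x Us]; rewrite step //.
under eq_bigr do rewrite IHs //.
by rewrite sum_bin_conv_shift [in RHS]big_cons.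
Qed.

Lemma size_compositions (x : T) (s : seq T) (M : nat) :
  uniq (x :: s) -> size (compositions (x :: s) M) = 'C(M + size s, size s).
Proof.
move=> Us; have:= sum_compositions_bin (fun=> 0%N) M Us.
rewrite [\sum_(y <- _) 0]big1 // add0n => <-; rewrite -sum1_size.
by apply: eq_bigr => v _; rewrite big1 // => y _; rewrite bin0.
Qed.

End Compositions.

Lemma ffactnD (n m k : nat) : (n ^_ (m + k) = n ^_ m * (n - m) ^_ k)%N.
Proof.
elim: k => [|k IHk]; first by rewrite addn0 ffactn0 muln1.
by rewrite addnS !ffactnSr IHk subnDA mulnA.
Qed.

Lemma ffact_leq_exp (n m : nat) : (n ^_ m <= n ^ m)%N.
Proof.
elim: m => [|m IHm]; rewrite ?ffactn0 ?expn0 // ffactnSr expnSr.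
by rewrite leq_mul // leq_subr.
Qed.

(** Each of the [a] factors [M - i] falls short of [M] by less than [a], so the relative error is at
    most [a ^ 2 / M]; denominators are cleared. *)
Lemma exp_leq_ffact (M a : nat) : (M ^ a * M <= M ^_ a * M + a * a * M ^ a)%N.
Proof.
elim: a => [|a IHa]; first by rewrite expn0 ffactn0; lia.
have le_ff := ffact_leq_exp M a; rewrite ffactnSr expnSr.
(* If [M <= a], the error term alone is at least the left side. *)
have [le_Ma|lt_aM] := leqP M a; first by nia.
have /subnKC DM := ltnW lt_aM; set b := (M - a)%N in DM *.
have : (M * (M ^ a * M) <= M * (M ^_ a * M + a * a * M ^ a))%N by rewrite leq_mul.
have : (M ^_ a * a * M <= M ^ a * a * M)%N by rewrite !leq_mul.
nia.
Qed.

Section SimplexMoments.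

Variable C : numFieldType.
Hypothesis C_archi : forall x : C, 0 <= x -> exists n : nat, x <= n%:R.

(** Divide by [M] and let [M] grow: by the Archimedean property the defect [V * q / M] drops below
    any positive [V - B]. *)
Lemma ler_of_vanishing_defect (V B q : C) : 0 <= V -> 0 <= q ->
  (forall M : nat, (0 < M)%N -> V * M%:R <= B * M%:R + V * q) -> V <= B.
Proof.
move=> V_ge0 q_ge0 leVB; have V_real := ger0_real V_ge0.
(* The order of [C] is only partial, so [B] must be known to be real before [V <= B] can be negated;
   the case [M = 1] compares it with a real number. *)
have B_real : B \is Num.real.
  have:= leVB 1%N isT; rewrite !mulr1 -lerBlDr => /ler_real <-.
  by rewrite realB ?realM // ger0_real.
rewrite real_leNgt //; apply/negP=> ltBV; have VB_gt0 : 0 < V - B by rewrite subr_gt0.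
have [n le_n] := C_archi (divr_ge0 (mulr_ge0 V_ge0 q_ge0) (ltW VB_gt0)).
have:= leVB n.+1 isT; rewrite -lerBlDl -mulrBl mulrC -ler_pdivlMr //.
by move/le_trans=> /(_ _ le_n); rewrite ler_nat ltnn.
Qed.

Variables (T : eqType) (W : finType) (P : pred W) (X : W -> C) (m : W -> T -> nat).
Variables (x : T) (s : seq T) (a : nat) (B : C).
Hypotheses (X_ge0 : forall w, 0 <= X w) (Us : uniq (x :: s)).
Hypothesis sum_m : forall w, P w -> (\sum_(y <- x :: s) m w y)%N = a.

(* The uniform measure on the points v / M, where v runs over the compositions
   of M, tends to the uniform measure on the simplex; replacing powers by
   falling factorials bounds its moments from below. *)
Lemma simplex_moments :
  (forall nu : T -> C, (forall y, 0 <= nu y) -> \sum_(y <- x :: s) nu y = 1 ->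
     \sum_(w | P w) X w * \prod_(y <- x :: s) nu y ^+ m w y <= B) ->
  \sum_(w | P w) X w * (\prod_(y <- x :: s) (m w y)`!)%:R *
    ((size s)`!%:R / (a + size s)`!%:R) <= B.
Proof.
move=> leB; set p := size s; rewrite -mulr_suml.
set U := \sum_(w | P w) _; set V := U * _.
have U_ge0 : 0 <= U by apply: sumr_ge0 => w _; rewrite mulr_ge0 ?ler0n.
have V_ge0 : 0 <= V by rewrite mulr_ge0 ?divr_ge0 ?ler0n.
apply: (@ler_of_vanishing_defect _ _ (a * a)%:R); rewrite ?ler0n // => M M_gt0.
have MR_gt0 : 0 < M%:R :> C by rewrite ltr0n.
(* The hypothesis is added up over the points [v / M], of which there are ['C(M + p, p)]. *)
have leU : U * 'C(M + p, a + p)%:R <= B * M%:R ^+ a * 'C(M + p, p)%:R.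
  have -> : B * M%:R ^+ a * 'C(M + p, p)%:R =
      \sum_(v <- compositions (x :: s) M) B * M%:R ^+ a.
    by rewrite big_const_seq count_predT size_compositions // iter_addr_0 mulr_natr.
  apply: (@le_trans _ _ (\sum_(v <- compositions (x :: s) M)
      \sum_(w | P w) X w * (\prod_(y <- x :: s) v y ^ m w y)%:R)).
    rewrite exchange_big mulr_suml; apply: ler_sum => w Pw /=.
    rewrite -mulr_sumr -mulrA ler_wpM2l // -natr_sum -natrM ler_nat.
    rewrite -(sum_m Pw) -(sum_compositions_bin (m w) M Us) big_distrr /=.
    apply: leq_sum => v _; rewrite -big_split /=; apply: leq_prod => y _.
    by rewrite mulnC bin_ffact ffact_leq_exp.
  elim: compositions (all_compositions M Us) => [|v r IHr]; first by rewrite !big_nil.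
  case/andP=> /eqP sum_v /IHr le_r; rewrite !big_cons lerD //.
  have:= leB (fun y => (v y)%:R / M%:R); rewrite -ler_pdivrMr ?exprn_gt0 //.
  rewrite -mulr_suml -natr_sum sum_v divff ?gt_eqF // => /(_ _ erefl) leBv.
  apply: le_trans (leBv _) => [|y]; last by rewrite divr_ge0 ?ler0n.
  rewrite mulr_suml; apply: ler_sum => w Pw; rewrite -mulrA ler_wpM2l //.
  under [leRHS]eq_bigr do rewrite expr_div_n.
  rewrite -(sum_m Pw) natr_prod -prodrXr -prodf_div.
  rewrite (eq_bigr (fun y => (v y)%:R ^+ m w y / M%:R ^+ m w y)) // => y _.
  by rewrite natrX.
(* Since [(M + p) ^_ (p + a)] is [(M + p) ^_ p * M ^_ a], the quotient of the two binomials is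
   [M ^_ a * p! / (a + p)!]. *)
have {leU} leV : V * (M ^_ a)%:R <= B * M%:R ^+ a.
  have fp_gt0 : 0 < ((M + p) ^_ p)%:R :> C by rewrite ltr0n ffact_gt0 leq_addl.
  have fap : ((M + p) ^_ p)%:R * (M ^_ a)%:R = 'C(M + p, a + p)%:R * (a + p)`!%:R :> C.
    by rewrite -!natrM bin_ffact (addnC a) ffactnD addnK.
  have fpp : ((M + p) ^_ p)%:R = 'C(M + p, p)%:R * p`!%:R :> C.
    by rewrite -natrM bin_ffact.
  rewrite -(ler_pM2r fp_gt0) -mulrA [_ * ((M + p) ^_ p)%:R]mulrC fap fpp /V.
  have ap_neq0 : (a + p)`!%:R != 0 :> C by rewrite pnatr_eq0 -lt0n fact_gt0.
  have -> : U * (p`!%:R / (a + p)`!%:R) * ('C(M + p, a + p)%:R * (a + p)`!%:R)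
      = U * 'C(M + p, a + p)%:R * p`!%:R by field.
  by rewrite [leRHS]mulrA ler_wpM2r ?ler0n.
rewrite -(ler_pM2r (exprn_gt0 a MR_gt0)) mulrDl.
have: V * (M ^ a * M)%:R <= V * (M ^_ a * M + a * a * M ^ a)%:R.
  by rewrite ler_wpM2l // ler_nat exp_leq_ffact.
rewrite natrD !(natrM _ _ M) (natrM _ _ (M ^ a)) natrX => leVM.
rewrite -mulrA [M%:R * _]mulrC; apply: le_trans leVM _.
rewrite mulrDr lerD //; last by rewrite mulrA.
by rewrite mulrA -[B * _ * _]mulrA [M%:R * _]mulrC mulrA ler_wpM2r ?ler0n.
Qed.

End SimplexMoments.

Section BlockMoments.

Variable C : numFieldType.
Hypothesis C_archi : forall x : C, 0 <= x -> exists n : nat, x <= n%:R.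
Variables (k : nat) (K W : finType) (b : K -> 'I_k).
Variables (P : pred W) (X : W -> C) (m : W -> K -> nat).
Variables (a : 'I_k -> nat) (sigma : 'I_k -> C) (B : C).
Hypothesis X_ge0 : forall w, 0 <= X w.
Hypothesis sigma_ge0 : forall j, 0 <= sigma j.
Hypothesis block_gt0 : forall j, (0 < #|[pred x | b x == j]|)%N.
Hypothesis sum_m : forall w, P w -> forall j, (\sum_(x | b x == j) m w x)%N = a j.

(* Up to the factor \prod_x (m w x)`!, this is the mean of a monomial of degree
   a j over the simplex of mass sigma j spanned by block j. *)
Definition block_factor (j : 'I_k) : C :=
  sigma j ^+ a j *
  ((#|[pred x | b x == j]| - 1)`!%:R / (a j + #|[pred x | b x == j]| - 1)`!%:R).

(** The blocks are averaged one after another, each by [simplex_moments], while the factors of the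
    other blocks are absorbed into the weights. *)
Lemma block_moments :
  (forall rho : K -> C, (forall x, 0 <= rho x) ->
     (forall j, \sum_(x | b x == j) rho x = sigma j) ->
     \sum_(w | P w) X w * \prod_x rho x ^+ m w x <= B) ->
  \sum_(w | P w) X w * (\prod_x (m w x)`!)%:R * \prod_j block_factor j <= B.
Proof.
move=> leB; have block_factor_ge0 j : 0 <= block_factor j.
  by rewrite mulr_ge0 ?exprn_ge0 ?divr_ge0 ?ler0n.
pose valid (rho : K -> C) := (forall x, 0 <= rho x) /\
  (forall j, \sum_(x | b x == j) rho x = sigma j).
(* In [G js] the blocks in [js] are already averaged to factorials; the others are still monomials
   in [rho]. *)
pose G (js : seq 'I_k) rho w x : C := if b x \in js then (m w x)`!%:R else rho x ^+ m w x.
have main js : uniq js -> forall rho : K -> C, valid rho ->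
    \sum_(w | P w) X w * \prod_x G js rho w x * \prod_(j <- js) block_factor j <= B.
  elim: js => [|j js IHjs] /=.
    move=> _ rho [rho_ge0 /(leB _ rho_ge0)]; rewrite big_nil => leBrho.
    by under eq_bigr do rewrite mulr1.
  case/andP=> js'j /IHjs{}IHjs rho [rho_ge0 sum_rho].
  pose A := [pred x | b x == j]; case EA: (enum A) => [|x0 s].
    by have:= block_gt0 j; rewrite cardE -/A EA.
  pose X' w := X w * \prod_(x | b x != j) G js rho w x *
    \prod_(i <- js) block_factor i * sigma j ^+ a j.
  have X'_ge0 w : 0 <= X' w.
    rewrite !mulr_ge0 ?exprn_ge0 ?prodr_ge0 // => x _.
    by rewrite /G; case: ifP; rewrite ?ler0n ?exprn_ge0.
  have sum_m' w : P w -> (\sum_(y <- x0 :: s) m w y)%N = a j.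
    by move=> Pw; rewrite -EA big_enum sum_m.
  have Us : uniq (x0 :: s) by rewrite -EA enum_uniq.
  have cardA : #|A| = (size s).+1 by rewrite cardE EA.
  have /(simplex_moments C_archi X'_ge0 Us sum_m') : forall nu : K -> C,
      (forall y, 0 <= nu y) -> \sum_(y <- x0 :: s) nu y = 1 ->
      \sum_(w | P w) X' w * \prod_(y <- x0 :: s) nu y ^+ m w y <= B.
    move=> nu nu_ge0; rewrite -EA big_enum /= => sum_nu.
    (* On block [j] the point [nu] of the unit simplex is scaled to mass [sigma j]; the other blocks
       keep [rho]. *)
    pose rho' x := if b x == j then sigma j * nu x else rho x.
    have /IHjs : valid rho'.
      split=> [x|i]; first by rewrite /rho'; case: ifP; rewrite ?mulr_ge0.
      have [->|neq_ij] := eqVneq i j.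
        rewrite (eq_bigr (fun x => sigma j * nu x)) -?mulr_sumr ?sum_nu ?mulr1 //.
        by move=> x bx; rewrite /rho' bx.
      rewrite -(sum_rho i); apply: eq_bigr => x /eqP bx.
      by rewrite /rho' bx (negPf neq_ij).
    apply: le_trans; apply: ler_sum => w Pw; rewrite big_enum /=.
    rewrite [X in _ <= _ * X * _](bigID (fun x => b x == j)) /=.
    rewrite [X in _ <= _ * (X * _) * _](eq_bigr (fun x =>
      sigma j ^+ m w x * nu x ^+ m w x)).
      rewrite big_split /= prodrXr sum_m //.
      rewrite [X in _ <= _ * (_ * X) * _](eq_bigr (G js rho w)).
        by rewrite le_eqVlt; apply/orP; left; apply/eqP; rewrite /X'; ring.
      by move=> x /negPf bx; rewrite /G /rho' bx.
    by move=> x /eqP bx; rewrite /G /rho' bx eqxx (negPf js'j) exprMn.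
  apply: le_trans; apply: ler_sum => w Pw; rewrite le_eqVlt; apply/orP; left; apply/eqP.
  rewrite big_cons {1}/block_factor -/A cardA addnS !subn1 /= -EA big_enum /= /X'.
  rewrite (bigID (fun x => b x == j)) /=.
  rewrite (eq_bigr (fun x => (m w x)`!%:R)) -?natr_prod.
    rewrite (eq_bigr (G js rho w)); first by ring.
    by move=> x /negPf bx; rewrite /G inE bx.
  by move=> x bx; rewrite /G inE bx.
(* Once every block is averaged, [rho] has dropped out; the even distribution within each block
   serves as a valid point. *)
have := main (enum 'I_k) (enum_uniq _) (fun x => sigma (b x) / #|[pred y | b y == b x]|%:R).
rewrite big_enum /=; under eq_bigr => w _.
  rewrite (eq_bigr (fun x => (m w x)`!%:R)) -?natr_prod; last first.
    by move=> x _; rewrite /G mem_enum.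
  over.
apply; split=> [x|j]; first by rewrite divr_ge0 ?ler0n.
rewrite (eq_bigr (fun=> sigma j / #|[pred y | b y == j]|%:R)); last by move=> x /eqP->.
by rewrite sumr_const -[_ *+ _]mulr_natr divfK // pnatr_eq0 -lt0n.
Qed.

End BlockMoments.

(** * Words and their rearrangements *)

(** Such a permutation amounts to an independent choice of a permutation of each fibre of [w]: [res]
    restricts to the fibres, and gluing goes back. *)
Lemma card_fiber_preserving (T K : finType) (w : T -> K) :
  #|[set s : {perm T} | [forall x, w (s x) == w x]]|
    = (\prod_y #|[set x | w x == y]|`!)%N.
Proof.
pose fib y := [set x | w x == y]; set S := [set s | _].
pose F y : pred {perm T} := perm_on (fib y).
transitivity #|(family F : simpl_pred {ffun K -> {perm T}})|; last first.
  rewrite card_family foldrE big_map big_enum /=.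
  by apply: eq_bigr => y _; rewrite -card_perm.
pose res s : {ffun K -> {perm T}} := [ffun y => restr_perm (fib y) s].
have resE s x : s \in S -> restr_perm (fib (w x)) s x = s x.
  rewrite inE => /forallP ws; rewrite restr_permE ?inE //.
  by apply/subsetP=> z; rewrite !inE => /eqP zx; rewrite /= apermE (eqP (ws z)) zx.
rewrite -(card_in_imset (f := res) (D := mem S)); last first.
  move=> s t Ss St /ffunP eq_st; apply/permP=> x.
  by rewrite -[LHS]resE // -[RHS]resE //; have:= eq_st (w x); rewrite !ffunE => ->.
apply: eq_card => h; apply/imsetP/familyP=> [[s Ss ->] y | Fh].
  by rewrite ffunE; exact: restr_perm_on.
have wh x y : w (h y x) = y <-> w x = y.
  have:= perm_closed x (Fh y); rewrite !inE => wE.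
  by split=> /eqP; [rewrite wE | rewrite -wE] => /eqP.
(* Gluing is injective because [h (w x)] keeps [x] in its fibre, so equal values come from the same
   fibre. *)
have inj_h : injective (fun x => h (w x) x).
  move=> x y eq_xy; have eq_w : w x = w y.
    by have /wh <- := erefl (w x); rewrite eq_xy; apply/wh.
  by move: eq_xy; rewrite eq_w => /perm_inj.
have Sh : perm inj_h \in S.
  by rewrite inE; apply/forallP=> x; rewrite permE; apply/eqP/wh.
exists (perm inj_h) => //; apply/ffunP=> y; rewrite ffunE; apply/permP=> x.
have [/eqP <-|nfib] := boolP (w x == y); first by rewrite resE // permE.
rewrite (out_perm (restr_perm_on _ _)) ?inE //.
by rewrite (out_perm (Fh y)) ?inE.
Qed.

Section WordPermutations.

Variables (n : nat) (K : finType).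
Implicit Types (w : {ffun 'I_n -> K}) (s : 'S_n).

Definition occ w x := #|[set i | w i == x]|.

Definition permute_word w s : {ffun 'I_n -> K} := [ffun i => w (s i)].

Definition occ_fact w := (\prod_x (occ w x)`!)%N.

Definition same_occ w w' := [forall x, occ w x == occ w' x].

Lemma permute_wordM w s t :
  permute_word (permute_word w s) t = permute_word w (t * s)%g.
Proof. by apply/ffunP=> i; rewrite !ffunE permM. Qed.

Lemma permute_word_bij s : bijective (permute_word^~ s).
Proof.
by exists (permute_word^~ s^-1%g) => w; rewrite permute_wordM ?mulVg ?mulgV;
  apply/ffunP=> i; rewrite ffunE perm1.
Qed.

Lemma occ_permute w s : occ (permute_word w s) =1 occ w.
Proof.
move=> x; rewrite /occ -[RHS](card_preimset _ (@perm_inj _ s)); apply: eq_card => i.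
by rewrite !inE ffunE.
Qed.

Lemma same_occP w w' : reflect (occ w =1 occ w') (same_occ w w').
Proof. by apply: (iffP forallP) => eq_w x; apply/eqP/eq_w. Qed.

Lemma occ_fact_gt0 w : (0 < occ_fact w)%N.
Proof. by rewrite prodn_gt0 // => x; rewrite fact_gt0. Qed.

(** If some [s0] carries [w] to [w'], the permutations doing so form a coset of the stabiliser of
    [w], whose order is [occ_fact w] by [card_fiber_preserving]. *)
Lemma card_permute_word w w' :
  #|[set s | permute_word w s == w']| = if same_occ w w' then occ_fact w else 0%N.
Proof.
case: same_occP => [eq_w|neq_w]; last first.
  apply/eqP; rewrite cards_eq0; apply/eqP/setP=> s; rewrite !inE.
  by apply/eqP=> eq_w; case: neq_w => x; rewrite -eq_w occ_permute.
(* Equal occurrence numbers make the two lists of letters rearrangements of each other, which yields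
   [s0]. *)
have /tuple_permP[s0 /eq_in_map Es0] :
    perm_eq [seq w' i | i <- enum 'I_n] [tuple w i | i < n].
  apply/allP=> x _; apply/eqP.
  have countE (u : {ffun 'I_n -> K}) : count_mem x [seq u i | i <- enum 'I_n] = occ u x.
    by rewrite count_map /occ cardsE cardE size_filter enumT.
  by rewrite !countE.
have Ew' : permute_word w s0 = w'.
  by apply/ffunP=> i; rewrite ffunE Es0 ?mem_enum // tnth_mktuple.
rewrite -{}Ew' {w' eq_w Es0} -[occ_fact w](card_fiber_preserving w).
rewrite -[LHS](card_preimset _ (mulgI s0)); apply: eq_card => s; rewrite !inE -permute_wordM.
apply/eqP/forallP=> [/(bij_inj (permute_word_bij s0)) ws x | ws].
  by rewrite -[in X in _ == X]ws ffunE.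
by congr permute_word; apply/ffunP=> x; rewrite ffunE; apply/eqP.
Qed.

End WordPermutations.

(** * Roots of unity and averages over phases *)

Lemma closed_prim_root_exists (C : numClosedFieldType) (Q : nat) :
  (0 < Q)%N -> exists z : C, Q.-primitive_root z.
Proof.
move=> Q_gt0; pose p : {poly C} := 'X^Q - 1.
have [r Dp] := closed_field_poly_normal p.
rewrite (monicP _) ?monicXnsubC // scale1r in Dp.
have rn1 : all Q.-unity_root r by apply/allP=> z; rewrite -root_prod_XsubC -Dp.
have sz_r : (Q < (size r).+1)%N by rewrite -(size_prod_XsubC r id) -Dp size_XnsubC.
have [|z] := hasP (has_prim_root Q_gt0 rn1 _ sz_r); last by exists z.
by rewrite -separable_prod_XsubC -Dp separable_Xn_sub_1 // pnatr_eq0 -lt0n.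
Qed.

Lemma norm_prim_root (C : numClosedFieldType) (Q : nat) (z : C) :
  Q.-primitive_root z -> `|z| = 1.
Proof.
move=> prim_z; have Q_gt0 := prim_order_gt0 prim_z.
apply/eqP; rewrite -(@eqrXn2 _ Q) ?ler01 ?normr_ge0 // -normrX.
by rewrite (prim_expr_order prim_z) normr1 expr1n.
Qed.

(** A geometric sum whose ratio [y] is a [Q]-th root of unity; [y = 1] forces [m = m'], as both
    exponents are below [Q]. *)
Lemma sum_prim_root (C : numClosedFieldType) (Q : nat) (z : C) (m m' : nat) :
    Q.-primitive_root z -> (m < Q)%N -> (m' < Q)%N ->
  \sum_(q < Q) (z ^+ q) ^+ m * ((z ^+ q)^* ) ^+ m' = (Q * (m == m'))%:R.
Proof.
move=> prim_z ltmQ ltm'Q.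
have norm_z := norm_prim_root prim_z.
pose y := z ^+ m * (z^* ) ^+ m'.
have zzc : z * z^* = 1 by rewrite -normCK norm_z expr1n.
have yQ : y ^+ Q = 1.
  rewrite exprMn -!exprM ![(_ * Q)%N]mulnC !exprM -rmorphXn.
  by rewrite (prim_expr_order prim_z) rmorph1 !expr1n mulr1.
rewrite (eq_bigr (fun q : 'I_Q => y ^+ q)); last first.
  by move=> q _; rewrite exprMn rmorphXn -!exprM ![(q * _)%N]mulnC.
case: eqP => [eq_m | /eqP neq_m].
  rewrite muln1 (eq_bigr (fun=> 1)) ?sumr_const ?card_ord // => q _.
  by rewrite /y eq_m -exprMn zzc !expr1n.
rewrite muln0; apply: (mulfI (x := y - 1)); last by rewrite -subrX1 yQ subrr mulr0.
rewrite subr_eq0; apply: contra neq_m => /eqP y1.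
suff: z ^+ m == z ^+ m' by rewrite (eq_prim_root_expr prim_z) !modn_small.
by rewrite -[z ^+ m]mulr1 -(expr1n _ m') -zzc exprMn mulrCA -/y y1 mulr1.
Qed.

Section TorusAverage.

Variables (C : numClosedFieldType) (n : nat) (K : finType).
Variable f : {ffun 'I_n -> K} -> C.

Definition symmetrized (w : {ffun 'I_n -> K}) : C := \sum_s f (permute_word w s).

Lemma symmetrized_permute w s : symmetrized (permute_word w s) = symmetrized w.
Proof.
rewrite /symmetrized [RHS](reindex_inj (mulIg s)).
by apply: eq_bigr => t _; rewrite permute_wordM.
Qed.

(** Each rearrangement of [w] is reached by [occ_fact w] permutations. Thus [symmetrized w] is a
    product of factorials times the coefficient, in the form [\sum_w f w * \prod_i t (w i)], of the
    monomial with exponents [occ w]. *)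
Lemma symmetrizedE w :
  symmetrized w = (occ_fact w)%:R * \sum_(w' | same_occ w w') f w'.
Proof.
rewrite /symmetrized (partition_big (permute_word w) predT) //= mulr_sumr.
rewrite [RHS]big_mkcond; apply: eq_bigr => w' _.
rewrite (eq_bigr (fun=> f w')) => [|s /eqP-> //].
rewrite sumr_const -[LHS]mulr_natl -cardsE card_permute_word.
by case: ifP; rewrite // mul0r.
Qed.

(** The other two factors are invariant under rearrangement, so [f w] may be replaced by its mean
    over ['S_n], which is [symmetrized w] divided by [n!]. *)
Lemma sum_mul_symmetrized (g : {ffun 'I_n -> K} -> C) :
    (forall w s, g (permute_word w s) = g w) ->
  \sum_w f w * (symmetrized w)^* * g w =
  (n`!)%:R^-1 * \sum_w `|symmetrized w| ^+ 2 * g w.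
Proof.
move=> g_inv; have fact_neq0 : (n`!)%:R != 0 :> C by rewrite pnatr_eq0 -lt0n fact_gt0.
apply: (mulfI fact_neq0); rewrite mulVKf //.
transitivity (\sum_(s : 'S_n) \sum_w f w * (symmetrized w)^* * g w).
  by rewrite sumr_const card_Sn mulr_natl.
rewrite [RHS](eq_bigr (fun w => \sum_(s : 'S_n)
    f (permute_word w s) * (symmetrized w)^* * g w)); last first.
  by move=> w _; rewrite normCK -!mulr_suml.
rewrite [RHS]exchange_big; apply: eq_bigr => s _.
rewrite (reindex_inj (bij_inj (permute_word_bij K s))).
by apply: eq_bigr => w _; rewrite symmetrized_permute g_inv.
Qed.

Lemma prod_word (t : K -> C) (w : {ffun 'I_n -> K}) :
  \prod_i t (w i) = \prod_x t x ^+ occ w x.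
Proof.
rewrite (partition_big w predT) //=; apply: eq_bigr => x _.
rewrite (eq_bigr (fun=> t x)) => [|i /eqP-> //].
by rewrite prodr_const /occ cardsE.
Qed.

(* Averaging over the torus of points whose coordinates have fixed moduli
   removes all products of distinct monomials; roots of unity of order > n
   suffice because the degree is n. *)
Lemma torus_average (rho : K -> C) (B : C) : (forall x, 0 <= rho x) ->
    (forall t : K -> C, (forall x, `|t x| ^+ 2 = rho x) ->
       `|\sum_w f w * \prod_i t (w i)| ^+ 2 <= B) ->
  \sum_(w : {ffun 'I_n -> K}) `|symmetrized w| ^+ 2 / (n`! * occ_fact w)%:R *
     \prod_x rho x ^+ occ w x <= B.
Proof.
move=> rho_ge0 leB; pose Q := n.+1.
have [z prim_z] := closed_prim_root_exists C (ltn0Sn n).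
have norm_z := norm_prim_root prim_z.
have occ_ltQ (w : {ffun 'I_n -> K}) x : (occ w x < Q)%N.
  by rewrite ltnS /occ -[n in (_ <= n)%N]card_ord max_card.
(* Here [e] runs over all choices of a [Q]-th root of unity as the phase of each coordinate. *)
pose t (e : {ffun K -> 'I_Q}) x := sqrtC (rho x) * z ^+ e x.
have norm_t e x : `|t e x| ^+ 2 = rho x.
  by rewrite normrM normrX norm_z expr1n mulr1 ger0_norm ?sqrtC_ge0 ?sqrtCK.
have QK_gt0 : 0 < #|{ffun K -> 'I_Q}|%:R :> C.
  by rewrite ltr0n card_ffun card_ord expn_gt0.
rewrite -(ler_pM2l QK_gt0).
apply: (@le_trans _ _ (\sum_e `|\sum_w f w * \prod_i t e (w i)| ^+ 2)); last first.
  rewrite mulr_natl -sumr_const; apply: ler_sum => e _; exact/leB/norm_t.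
rewrite le_eqVlt; apply/orP; left; apply/eqP.
pose g (w : {ffun 'I_n -> K}) : C := (occ_fact w)%:R^-1 * \prod_x rho x ^+ occ w x.
have g_inv w s : g (permute_word w s) = g w.
  by congr (_%:R^-1 * _); apply: eq_bigr => x _; rewrite occ_permute.
transitivity (#|{ffun K -> 'I_Q}|%:R * \sum_w f w * (symmetrized w)^* * g w).
  congr (_ * _); rewrite sum_mul_symmetrized // mulr_sumr; apply: eq_bigr => w _.
  by rewrite natrM invfM /g; ring.
transitivity (\sum_e \sum_w \sum_w' f w * (f w')^* *
    \prod_x (t e x ^+ occ w x * (t e x)^* ^+ occ w' x)); last first.
  apply: eq_bigr => e _; rewrite normCK rmorph_sum big_distrlr /=.
  apply: eq_bigr => w _; apply: eq_bigr => w' _.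
  rewrite rmorphM rmorph_prod /= (prod_word (t e)) (prod_word (fun x => (t e x)^*)).
  by rewrite big_split /=; ring.
rewrite exchange_big mulr_sumr; apply: eq_bigr => w _ /=; rewrite exchange_big /=.
rewrite symmetrizedE rmorphM rmorph_nat /g rmorph_sum.
have occ_neq0 : (occ_fact w)%:R != 0 :> C by rewrite pnatr_eq0 -lt0n occ_fact_gt0.
transitivity (\sum_(w' | same_occ w w') f w * (f w')^* *
    (#|{ffun K -> 'I_Q}|%:R * \prod_x rho x ^+ occ w x)).
  by rewrite -mulr_suml -mulr_sumr; field.
rewrite big_mkcond; apply: eq_bigr => w' _; rewrite -mulr_sumr.
(* A sum over all choices of phases of a product over [x] is a product of sums over one phase
   each. *)
rewrite -(bigA_distr_bigA (fun x (q : 'I_Q) => (sqrtC (rho x) * z ^+ q) ^+ occ w x *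
  (sqrtC (rho x) * z ^+ q)^* ^+ occ w' x)) /=.
have sumE x : \sum_(q < Q) (sqrtC (rho x) * z ^+ q) ^+ occ w x *
      (sqrtC (rho x) * z ^+ q)^* ^+ occ w' x =
    (Q * (occ w x == occ w' x))%:R * rho x ^+ occ w x.
  rewrite (eq_bigr (fun q : 'I_Q => sqrtC (rho x) ^+ (occ w x + occ w' x) *
      ((z ^+ q) ^+ occ w x * (z ^+ q)^* ^+ occ w' x))); last first.
    move=> q _; rewrite rmorphM /= (geC0_conj (_ : 0 <= sqrtC _)) ?sqrtC_ge0 //.
    by rewrite !exprMn exprD; ring.
  rewrite -mulr_sumr sum_prim_root //; case: eqP => [<-|_]; last first.
    by rewrite muln0 mulr0 mul0r.
  by rewrite muln1 mulrC addnn -muln2 mulnC exprM sqrtCK.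
(* One differing exponent makes the product zero, so exactly the words [w'] that enter
   [symmetrizedE] survive. *)
rewrite (eq_bigr _ (fun x _ => sumE x)); case: ifP => [/same_occP eq_w | ].
  rewrite [in RHS](eq_bigr (fun x => Q%:R * rho x ^+ occ w x)); last first.
    by move=> x _; rewrite -eq_w eqxx muln1.
  by rewrite big_split prodr_const -natrX card_ffun card_ord.
move/negbT; rewrite negb_forall => /existsP[x neq_x].
by rewrite (bigD1 x) //= (negPf neq_x) muln0 !mul0r mulr0.
Qed.

End TorusAverage.

(** * Symmetrized coefficients of a product of linear forms *)

Section BlockBound.

Variable C : numClosedFieldType.
Hypothesis C_archi : forall x : C, 0 <= x -> exists n : nat, x <= n%:R.
Variables (n k : nat) (K : finType) (b : K -> 'I_k) (M : K -> 'I_n -> C).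
Variables (a d : 'I_k -> nat).
Hypothesis n_gt0 : (0 < n)%N.
Hypothesis d_gt0 : forall j, (0 < d j)%N.
Hypothesis sum_a : (\sum_j a j)%N = n.
Hypothesis block_gt0 : forall j, (0 < #|[pred x | b x == j]|)%N.
Hypothesis norm_M : forall t : K -> C,
  \sum_i `|\sum_x t x * M x i| ^+ 2 = n%:R * \sum_x `|t x| ^+ 2 / (d (b x))%:R.

Definition word_prod (w : {ffun 'I_n -> K}) : C := \prod_i M (w i) i.

Definition block_occ (w : {ffun 'I_n -> K}) (j : 'I_k) := #|[set i | b (w i) == j]|.

(* The masses d_j a_j minimise (\sum_j s_j / d_j)^n / \prod_j s_j^(a_j). *)
Lemma sum_symmetrized_le :
  \sum_(w | [forall j, block_occ w j == a j]) `|symmetrized word_prod w| ^+ 2 *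
    \prod_j block_factor b a (fun j => (d j * a j)%:R : C) j
  <= (n`! * n ^ n)%:R.
Proof.
have fact_gt0 : 0 < (n`!)%:R :> C by rewrite ltr0n fact_gt0.
pose X w : C := `|symmetrized word_prod w| ^+ 2 / (n`! * occ_fact w)%:R.
have X_ge0 w : 0 <= X w by rewrite divr_ge0 ?exprn_ge0 ?normr_ge0 ?ler0n.
rewrite natrM -ler_pdivrMl // mulr_sumr.
(* The weight [X] comes from [torus_average]; its denominator [occ_fact w] cancels against the
   factorials produced by [block_moments]. *)
rewrite (eq_bigr (fun w => X w * (\prod_x (occ w x)`!)%:R *
    \prod_j block_factor b a (fun j => (d j * a j)%:R : C) j)); last first.
  move=> w _; rewrite mulrA /X natrM -/(occ_fact w).
  have occ_neq0 : (occ_fact w)%:R != 0 :> C by rewrite pnatr_eq0 -lt0n occ_fact_gt0.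
  by field; rewrite occ_neq0 gt_eqF.
apply: block_moments => // [w /forallP occ_w j | rho rho_ge0 sum_rho].
  rewrite -(eqP (occ_w j)) /block_occ -sum1dep_card.
  rewrite (partition_big w (fun x => b x == j)) //=; apply: eq_bigr => x /eqP bx.
  rewrite /occ -sum1dep_card; apply: eq_bigl => i.
  by case: eqP => [->|]; rewrite ?bx ?eqxx ?andbF.
(* Words with other block occurrences only add nonnegative terms. *)
apply: (@le_trans _ _ (\sum_w X w * \prod_x rho x ^+ occ w x)).
  rewrite [leRHS](bigID (fun w => [forall j, block_occ w j == a j])) /= lerDl.
  by apply: sumr_ge0 => w _; rewrite mulr_ge0 ?prodr_ge0 // => x _; rewrite exprn_ge0.
apply: torus_average => // t norm_t.
have -> : \sum_w word_prod w * \prod_i t (w i) = \prod_i \sum_x t x * M x i.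
  rewrite bigA_distr_bigA; apply: eq_bigr => w _.
  by rewrite -big_split /=; apply: eq_bigr => i _; rewrite mulrC.
rewrite normr_prod -prodrXl.
have n_neq0 : n%:R != 0 :> C by rewrite pnatr_eq0 -lt0n.
(* AM-GM for the [n] squared moduli: [norm_M] evaluates their mean as [\sum_x rho x / d (b x)], and
   the masses [d j * a j] make this [\sum_j a j = n]. *)
have := leif_AGM (A := 'I_n) (E := fun i => `|\sum_x t x * M x i| ^+ 2).
case=> [i _|]; first by rewrite exprn_ge0 ?normr_ge0.
rewrite norm_M card_ord mulrAC divff // mul1r => leAGM _.
rewrite natrX; apply: le_trans leAGM _; rewrite le_eqVlt; apply/orP; left; apply/eqP.
congr (_ ^+ _); rewrite (partition_big b predT) //= -sum_a natr_sum.
apply: eq_bigr => j _.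
rewrite (eq_bigr (fun x => rho x / (d j)%:R)) => [|x /eqP<-]; last by rewrite norm_t.
by rewrite -mulr_suml sum_rho natrM mulrAC divff ?mul1r // pnatr_eq0 -lt0n.
Qed.

End BlockBound.

(** * Matrix coefficients of unitary representations *)

Section SchurOrthogonality.

Variables (C : numClosedFieldType) (gT : finGroupType).
Local Notation reprC := (mx_representation C [set: gT]%G).

(** Schur's lemma for row vectors: the kernel and the image of [F] are submodules, so a nonzero [F]
    would be injective and onto, hence an isomorphism. *)
Lemma intertwiner_eq0 (m n : nat) (r1 : reprC m) (r2 : reprC n) (F : 'M_(m, n)) :
    mx_irreducible r1 -> mx_irreducible r2 -> ~ mx_rsim r1 r2 ->
  (forall x, r1 x *m F = F *m r2 x) -> F = 0.
Proof.
move=> /mx_irrP[_ irr1] /mx_irrP[_ irr2] nsim homF; apply/eqP.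
apply: contra_notT nsim => nzF.
have freeF : row_free F.
  rewrite -kermx_eq0; apply: contraNT nzF => nz_ker.
  have mod_ker : mxmodule r1 (kermx F).
    apply/mxmoduleP=> x _; apply/sub_kermxP.
    by rewrite -mulmxA homF mulmxA mulmx_ker mul0mx.
  have := irr1 _ mod_ker nz_ker; rewrite -sub1mx => /sub_kermxP.
  by rewrite mul1mx => ->.
have fullF : row_full <<F>>%MS.
  apply: irr2; last by rewrite -submx0 genmxE submx0.
  apply/mxmoduleP=> x _; rewrite (eqmxMr _ (genmxE F)) genmxE -homF; exact: submxMl.
have eq_mn : m = n.
  by have := eqP fullF; rewrite genmxE (eqP freeF).
exact: MxReprSim eq_mn freeF (fun x _ => homF x).
Qed.

(** For an eigenvalue [a], the matrix [F - a%:M] is a singular intertwiner, whereas irreducibility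
    makes nonzero ones invertible. *)
Lemma endo_scalar (m : nat) (r : reprC m) (F : 'M_m) :
    mx_irreducible r -> (forall x, r x *m F = F *m r x) ->
  exists a, F = a%:M.
Proof.
move=> irr homF; have [m_gt0 _] := (mx_irrP r).1 irr.
have [a /eigenvalueP[v vF nz_v]] := eigenvalue_closed F m_gt0; exists a.
apply/eqP; rewrite -subr_eq0; apply: contraNT nz_v => nzFa.
have uFa : F - a%:M \in unitmx.
  apply: (mx_Schur irr) nzFa; apply/centgmxP=> x _.
  by rewrite mulmxBl mulmxBr homF scalar_mxC.
by rewrite -(mulmxK uFa v) mulmxBr vF mul_mx_scalar subrr mul0mx.
Qed.

Lemma unitary_reprV (m : nat) (r : reprC m) x p q :
  unitary_repr r -> r x^-1%g p q = (r x q p)^*.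
Proof.
move=> uni; rewrite repr_mxV ?inE // invmx_unitary ?uni ?inE //.
by rewrite !mxE.
Qed.

Lemma average_intertwines (m n : nat) (r1 : reprC m) (r2 : reprC n) (A : 'M_(m, n)) x :
  r1 x *m (\sum_g r1 g *m A *m r2 g^-1%g) = (\sum_g r1 g *m A *m r2 g^-1%g) *m r2 x.
Proof.
rewrite mulmx_sumr mulmx_suml [RHS](reindex_inj (mulgI x)); apply: eq_bigr => g _.
by rewrite invMg !repr_mxM ?inE // !mulmxA repr_mxKV ?inE.
Qed.

(** Averaging an elementary matrix singles out one pair of matrix coefficients; unitarity turns the
    inverse into a conjugate. *)
Lemma average_delta (m n : nat) (r1 : reprC m) (r2 : reprC n) p q p' q' :
    unitary_repr r2 ->
  (\sum_g r1 g *m delta_mx q q' *m r2 g^-1%g) p p' = \sum_g r1 g p q * (r2 g p' q')^*.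
Proof.
move=> uni; rewrite summxE; apply: eq_bigr => g _.
have entry i j : (r1 g *m delta_mx q q') i j = r1 g i q * (j == q')%:R.
  rewrite mxE (bigD1 q) //= mxE eqxx big1 ?addr0 // => l /negPf neq_l.
  by rewrite mxE neq_l mulr0.
rewrite mxE (bigD1 q') //= entry eqxx mulr1 unitary_reprV // big1 ?addr0 // => j.
by move=> /negPf neq_j; rewrite entry neq_j mulr0 mul0r.
Qed.

Lemma Schur_orthogonality_diag (m : nat) (r : reprC m) p q p' q' :
    unitary_repr r -> mx_irreducible r ->
  \sum_g r g p q * (r g p' q')^* =
  #|[set: gT]|%:R / m%:R * ((p == p') && (q == q'))%:R.
Proof.
move=> uni irr; have [m_gt0 _] := (mx_irrP r).1 irr.
have nz_m : m%:R != 0 :> C by rewrite pnatr_eq0 -lt0n.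
rewrite -average_delta //; set F := \sum_g _.
have [a DF] : exists a, F = a%:M.
  exact: endo_scalar irr (average_intertwines _ _ _).
(* The scalar is read off the trace: by cyclicity every summand has the trace of [delta_mx q q']. *)
have : \tr F = #|[set: gT]|%:R * (q == q')%:R.
  rewrite raddf_sum /= (eq_bigr (fun=> (q == q')%:R)).
    by rewrite sumr_const cardsT mulr_natl.
  move=> g _; rewrite mxtrace_mulC mulmxA -repr_mxM ?inE // mulVg repr_mx1 mul1mx.
  rewrite /mxtrace (bigD1 q) //= !mxE eqxx big1 ?addr0 // => i /negPf.
  by rewrite !mxE => ->.
rewrite DF mxtrace_scalar mxE -mulnb natrM => tr_eq.
have -> : a = #|[set: gT]|%:R * (q == q')%:R / m%:R.
  by rewrite -tr_eq -[a *+ m]mulr_natr mulfK.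
by rewrite -[_ *+ (p == p')]mulr_natr; ring.
Qed.

Lemma Schur_orthogonality_nonsim (m n : nat) (r1 : reprC m) (r2 : reprC n) p q p' q' :
    unitary_repr r2 -> mx_irreducible r1 -> mx_irreducible r2 -> ~ mx_rsim r1 r2 ->
  \sum_g r1 g p q * (r2 g p' q')^* = 0.
Proof.
move=> uni irr1 irr2 nsim; rewrite -average_delta //.
by rewrite (intertwiner_eq0 irr1 irr2 nsim (average_intertwines _ _ _)) mxE.
Qed.

End SchurOrthogonality.

Section HSNorm.

Variables (C : numClosedFieldType) (gT : finGroupType) (G : {group gT}).

Lemma mxtrace_adjoint (m : nat) (A : 'M[C]_m) :
  \tr (A *m map_mx Num.conj A^T) = \sum_u \sum_v `|A u v| ^+ 2.
Proof.
rewrite /mxtrace; apply: eq_bigr => u _; rewrite mxE; apply: eq_bigr => v _.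
by rewrite !mxE normCK.
Qed.

(* For unitary representations both sides are sums of characters. *)
Lemma mxtrace_adjoint_rsim (m1 m2 : nat) (r1 : mx_representation C G m1)
    (r2 : mx_representation C G m2) (S : {set gT}) :
    S \subset G -> unitary_repr r1 -> unitary_repr r2 -> mx_rsim r1 r2 ->
  \tr ((\sum_(x in S) r1 x) *m map_mx Num.conj (\sum_(x in S) r1 x)^T) =
  \tr ((\sum_(x in S) r2 x) *m map_mx Num.conj (\sum_(x in S) r2 x)^T).
Proof.
move=> /subsetP sSG uni1 uni2 sim12.
have trE m (r : mx_representation C G m) : unitary_repr r ->
    \tr ((\sum_(x in S) r x) *m map_mx Num.conj (\sum_(x in S) r x)^T) =
    \sum_(x in S) \sum_(y in S) \tr (r (x * y^-1)%g).
  move=> uni; rewrite mulmx_suml raddf_sum; apply: eq_bigr => x /sSG Gx.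
  rewrite raddf_sum [map_mx _ _]raddf_sum mulmx_sumr raddf_sum.
  apply: eq_bigr => y /sSG Gy; rewrite repr_mxM ?groupV // repr_mxV //.
  by rewrite invmx_unitary ?uni.
rewrite !trE //; apply: eq_bigr => x /sSG Gx; apply: eq_bigr => y /sSG Gy.
by apply: mxtrace_rsim sim12 _ _; rewrite groupM ?groupV.
Qed.

End HSNorm.

Lemma tensor_unitary (C : numClosedFieldType) (n : nat) (d : 'I_n -> nat)
    (gT : finGroupType) (r : forall i, mx_representation C [set: gT]%G (d i)) :
  (forall i, unitary_repr (r i)) -> unitary_repr (tensor_repr r).
Proof.
move=> uni x _; apply/unitarymxP.
have -> : map_mx Num.conj (tensor_repr r x)^T = tensor_repr r x^-1%g.
  apply/matrixP=> u v; rewrite !mxE rmorph_prod; apply: eq_bigr => i _.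
  by rewrite ffunE unitary_reprV.
by rewrite -repr_mxM ?inE // mulgV repr_mx1.
Qed.

Lemma card_same_occ (n : nat) (K : finType) (c : {ffun 'I_n -> K}) :
  (#|[set c' | same_occ c c']| * occ_fact c = n`!)%N.
Proof.
rewrite -card_Sn -[RHS]sum1_card [RHS](partition_big (permute_word c) predT) //=.
rewrite -sum_nat_cond_const big_mkcond; apply: eq_bigr => c' _ /=.
by rewrite -card_permute_word -sum1dep_card; apply: eq_bigl.
Qed.

(** The rearrangements of [c] form a single orbit under ['S_n], on which [T] is constant; its size
    follows from [card_same_occ]. *)
Lemma sum_same_occ (V : nmodType) (n : nat) (K : finType)
    (c : {ffun 'I_n -> K}) (T : {ffun 'I_n -> K} -> V) :
    (forall c' s, T (permute_word c' s) = T c') ->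
  \sum_(c' | same_occ c c') T c' = T c *+ (n`! %/ occ_fact c).
Proof.
move=> T_inv; rewrite -(card_same_occ c) mulnK ?occ_fact_gt0 // -sumr_const.
rewrite (eq_bigl [in [set c' | same_occ c c']]) => [|c']; last by rewrite inE.
apply: eq_bigr => c'; rewrite inE => occ_c'.
have := card_permute_word c c'; rewrite occ_c' => card_s.
have : (0 < #|[set s | permute_word c s == c']|)%N by rewrite card_s occ_fact_gt0.
by case/card_gt0P=> s; rewrite inE => /eqP<-.
Qed.

Section MatrixCoefficients.

Variables (C : numClosedFieldType) (gT : finGroupType) (n k : nat).
Variables (g : 'I_n -> gT) (d : 'I_k -> nat).
Variable r : forall j : 'I_k, mx_representation C [set: gT]%G (d j).
Hypothesis g_bij : bijective g.
Hypothesis r_unitary : forall j, unitary_repr (r j).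
Hypothesis r_irr : forall j, mx_irreducible (r j).
Hypothesis r_noniso : forall i j, i != j -> ~ mx_rsim (r i) (r j).

Definition coef_index := {j : 'I_k & ('I_(d j) * 'I_(d j))%type}.

Definition coef (x : coef_index) (i : 'I_n) : C :=
  r (tag x) (g i) (tagged x).1 (tagged x).2.

Lemma card_coef_block (j : 'I_k) :
  #|[pred x : coef_index | tag x == j]| = (d j ^ 2)%N.
Proof.
pose h (pq : 'I_(d j) * 'I_(d j)) : coef_index := Tagged _ pq.
have inj_h : injective h.
  by move=> x y /eqP; rewrite -tag_eqE /tag_eq eqxx /= tagged_asE => /eqP.
rewrite -mulnn -{1 2}[d j]card_ord -card_prod -(card_codom inj_h).
apply: eq_card => -[i pq]; rewrite inE /=.
apply/eqP/codomP=> [eq_ij | [pq' /(congr1 tag)] //].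
by case: j / eq_ij @h inj_h => h _; exists pq.
Qed.

Lemma coef_orthogonal (x y : coef_index) :
  \sum_i coef x i * (coef y i)^* = n%:R / (d (tag x))%:R * (x == y)%:R.
Proof.
have card_gT : #|[set: gT]| = n.
  by rewrite cardsT -(bij_eq_card g_bij) card_ord.
have sumE (F : gT -> C) : \sum_i F (g i) = \sum_z F z.
  by rewrite [RHS](reindex g) //; exact: onW_bij.
case: x y => [j [p q]] [j' [p' q']].
rewrite /coef /= (sumE (fun z => r j z p q * (r j' z p' q')^*)).
have [eq_j | neq_j] := eqVneq j j'.
  case: j' / eq_j p' q' => p' q'; rewrite Schur_orthogonality_diag // card_gT.
  by rewrite -tag_eqE /tag_eq eqxx /= tagged_asE.
rewrite Schur_orthogonality_nonsim //; last exact: r_noniso.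
by rewrite -tag_eqE /tag_eq /= (negPf neq_j) mulr0.
Qed.

(** Parseval for the orthogonal vectors [coef x], of squared length [n / d_j]; this supplies the
    hypothesis [norm_M] of the block bound. *)
Lemma coef_norm (t : coef_index -> C) :
  \sum_i `|\sum_x t x * coef x i| ^+ 2 =
  n%:R * \sum_x `|t x| ^+ 2 / (d (tag x))%:R.
Proof.
transitivity (\sum_x \sum_y t x * (t y)^* * \sum_i coef x i * (coef y i)^*).
  under [RHS]eq_bigr do under eq_bigr do rewrite mulr_sumr.
  under [RHS]eq_bigr do rewrite exchange_big.
  rewrite [RHS]exchange_big; apply: eq_bigr => i _ /=.
  rewrite normCK rmorph_sum big_distrlr /=; apply: eq_bigr => x _.
  by apply: eq_bigr => y _; rewrite rmorphM /=; ring.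
rewrite [RHS]mulr_sumr; apply: eq_bigr => x _.
rewrite (bigD1 x) //= [X in _ + X]big1 ?addr0.
  by rewrite coef_orthogonal eqxx mulr1 normCK; ring.
by move=> y /negPf; rewrite eq_sym coef_orthogonal => ->; rewrite !mulr0.
Qed.

End MatrixCoefficients.

Section TensorCoefficients.

Variables (C : numClosedFieldType) (gT : finGroupType) (n k : nat).
Variables (g : 'I_n -> gT) (d : 'I_k -> nat).
Variable r : forall j : 'I_k, mx_representation C [set: gT]%G (d j).
Variable c : 'I_n -> 'I_k.
Hypothesis g_bij : bijective g.

Local Notation DF := {dffun forall i : 'I_n, 'I_(d (c i))}.

(** A row and a column index of the tensor product, read factor by factor: letter [i] is a position
    in the matrix of the [i]-th factor, tagged with the block [c i]. *)
Definition coef_word (UV : DF * DF) : {ffun 'I_n -> coef_index d} :=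
  [ffun i => Tagged (fun j => ('I_(d j) * 'I_(d j))%type) (UV.1 i, UV.2 i)].

Lemma coef_word_inj : injective coef_word.
Proof.
move=> [U V] [U' V'] /ffunP eq_UV.
have eq_i i : (U i, V i) = (U' i, V' i).
  have := eq_UV i; rewrite /coef_word !ffunE => /eqP.
  by rewrite -tag_eqE /tag_eq eqxx /= tagged_asE => /eqP.
by congr (_, _); apply/ffunP=> i; have [] := eq_i i.
Qed.

Lemma coef_word_image (w : {ffun 'I_n -> coef_index d}) :
  (w \in [set coef_word UV | UV in [set: DF * DF]]) =
  ([ffun i => tag (w i)] == [ffun i => c i]).
Proof.
apply/imsetP/eqP=> [[UV _ ->] | /ffunP tag_w].
  by apply/ffunP=> i; rewrite !ffunE.
have /fin_all_exists[h Dh] (i : 'I_n) :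
    exists pq : 'I_(d (c i)) * 'I_(d (c i)),
      w i = Tagged (fun j => ('I_(d j) * 'I_(d j))%type) pq.
  have := tag_w i; rewrite !ffunE; case: (w i) => j pq /= eq_j.
  by case: _ / eq_j; exists pq.
exists (([ffun i => (h i).1] : DF), ([ffun i => (h i).2] : DF)); rewrite ?inE //.
by apply/ffunP=> i; rewrite !ffunE Dh -surjective_pairing.
Qed.

(** As [g] enumerates the whole group, the tuples with distinct entries are exactly the
    rearrangements of [g], and the sum becomes one over ['S_n]. *)
Lemma sum_tensor_distinct u v :
  (\sum_(x in distinct_tuples gT n) tensor_repr (fun i => r (c i)) x) u v =
  symmetrized (word_prod (coef g r)) (coef_word (enum_val u, enum_val v)).
Proof.
have [ginv gK ginvK] := g_bij; have g_inj := can_inj gK.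
pose tup (s : 'S_n) : grp_pow gT n := [ffun i => g (s i)].
have -> : distinct_tuples gT n = tup @: setT.
  apply/setP=> x; rewrite inE; apply/injectiveP/imsetP=> [inj_x | [s _ ->]].
    have inj_s : injective (fun i => ginv (x i)).
      exact: inj_comp (can_inj ginvK) inj_x.
    by exists (perm inj_s) => //; apply/ffunP=> i; rewrite ffunE permE ginvK.
  by move=> i j; rewrite !ffunE => /g_inj/perm_inj.
rewrite big_imset /=; last first.
  by move=> s t _ _ /ffunP eq_st; apply/permP=> i; have:= eq_st i; rewrite !ffunE => /g_inj.
(* Permuting the group elements by [s] amounts to permuting the letters of the word by the inverse
   of [s]. *)
rewrite summxE /symmetrized [RHS](reindex_inj invg_inj); apply: eq_big => s.
  by rewrite inE.
move=> _; rewrite mxE /word_prod [RHS](reindex_inj (@perm_inj _ s)).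
by apply: eq_bigr => i _; rewrite !ffunE permK.
Qed.

Lemma sum_tensor_entries :
  \sum_u \sum_v `|(\sum_(x in distinct_tuples gT n)
                     tensor_repr (fun i => r (c i)) x) u v| ^+ 2 =
  \sum_(w : {ffun 'I_n -> coef_index d} | [ffun i => tag (w i)] == [ffun i => c i])
     `|symmetrized (word_prod (coef g r)) w| ^+ 2.
Proof.
under eq_bigr do under eq_bigr do rewrite sum_tensor_distinct.
rewrite -(eq_bigl _ _ coef_word_image) big_imset /=; last by move=> ? ? _ _ /coef_word_inj.
rewrite [RHS](eq_bigl xpredT) => [|UV]; last by rewrite inE.
rewrite -(pair_bigA _ (fun U V : DF =>
  `|symmetrized (word_prod (coef g r)) (coef_word (U, V))| ^+ 2)) /=.
rewrite [RHS](reindex _ (onW_bij _ (enum_val_bij _))); apply: eq_bigr => u _.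
by rewrite [RHS](reindex _ (onW_bij _ (enum_val_bij _))).
Qed.

End TensorCoefficients.

(** * The inequality for the Fourier coefficient *)

Lemma hat_1S_bound (C : numClosedFieldType)
    (C_archi : forall x : C, 0 <= x -> exists m : nat, x <= m%:R)
    (gT : finGroupType) (n k : nat) (d a : 'I_k -> nat)
    (r : forall j : 'I_k, mx_representation C [set: gT]%G (d j))
    (D : nat) (rho : mx_representation C [set: grp_pow gT n]%G D) (c : 'I_n -> 'I_k) :
    #|[set: gT]| = n -> (\sum_j a j)%N = n ->
    (forall j, unitary_repr (r j)) -> (forall j, mx_irreducible (r j)) ->
    (forall i j, i != j -> ~ mx_rsim (r i) (r j)) ->
    (forall j, #|[set i | c i == j]| = a j) ->
    unitary_repr rho -> mx_rsim rho (tensor_repr (fun i => r (c i))) ->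
  (multinomial n a)%:R * HS_norm (hat_1S rho) ^+ 2 * D%:R
    <= (n`!)%:R / (n ^ n)%:R *
       \prod_(j < k) (((a j + d j ^ 2 - 1)`!)%:R /
                      ((a j ^ a j)%:R * ((d j ^ 2 - 1)`!)%:R)).
Proof.
move=> card_G sum_a r_uni r_irr r_nsim c_mult rho_uni rho_tensor.
have n_gt0 : (0 < n)%N by rewrite -card_G cardG_gt0.
have d_gt0 j : (0 < d j)%N by have [] := (mx_irrP (r j)).1 (r_irr j).
have card_gT : n = #|gT| by rewrite -card_G cardsT.
pose g i := enum_val (cast_ord card_gT i).
have g_bij : bijective g.
  exact: bij_comp (enum_val_bij _) (Bijective (cast_ordK _) (cast_ordKV _)).
pose E := symmetrized (word_prod (coef g r)).
pose tg (w : {ffun 'I_n -> coef_index d}) := [ffun i => tag (w i)].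
(* [T c'] is the squared Hilbert-Schmidt norm, before normalisation, for the tensor product whose
   factors follow the pattern [c']. *)
pose T (c' : {ffun 'I_n -> 'I_k}) := \sum_(w | tg w == c') `|E w| ^+ 2.
pose cf := [ffun i => c i].
have occ_cf j : occ cf j = a j.
  by rewrite -c_mult; apply: eq_card => i; rewrite !inE ffunE.
have HS_eq : HS_norm (hat_1S rho) ^+ 2 = (n ^ n)%:R^-1 ^+ 2 * T cf.
  rewrite /HS_norm sqrtCK /hat_1S linearZ /= map_mxZ -scalemxAl -scalemxAr scalerA.
  rewrite linearZ /= geC0_conj ?invr_ge0 ?ler0n // -expr2; congr (_ * _).
  rewrite (mxtrace_adjoint_rsim (subsetT _) rho_uni (tensor_unitary _) rho_tensor) //.
  by rewrite mxtrace_adjoint (sum_tensor_entries _ _ g_bij).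
(* Reordering the tensor factors leaves the norm unchanged; this is where the multinomial
   coefficient comes from. *)
have T_inv c' s : T (permute_word c' s) = T c'.
  rewrite /T (reindex_inj (bij_inj (permute_word_bij _ s))); apply: eq_big => w.
    have -> : tg (permute_word w s) = permute_word (tg w) s.
      by apply/ffunP=> i; rewrite !ffunE.
    exact: (inj_eq (bij_inj (permute_word_bij _ s))).
  by rewrite /E symmetrized_permute.
have block_gt0 (j : 'I_k) : (0 < #|[pred x : coef_index d | tag x == j]|)%N.
  by rewrite card_coef_block expn_gt0 d_gt0.
have := sum_symmetrized_le C_archi n_gt0 d_gt0 sum_a block_gt0
  (coef_norm g_bij r_uni r_irr r_nsim).
(* Words with block occurrences [a] are grouped by their block pattern, which is a rearrangement of
   [cf]. *)
rewrite -mulr_suml (partition_big tg (same_occ cf)) /=; last first.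
  move=> w /forallP occ_w; apply/same_occP=> j; rewrite occ_cf -(eqP (occ_w j)).
  by apply: eq_card => i; rewrite !inE ffunE.
rewrite (eq_bigr T) => [|c' /same_occP occ_c']; last first.
  apply: eq_bigl => w; rewrite andb_idl // => /eqP tg_w; apply/forallP=> j.
  rewrite -occ_cf occ_c' -tg_w; apply/eqP/eq_card => i.
  by rewrite !inE ffunE.
rewrite (sum_same_occ _ T_inv) -[_ *+ _]mulr_natl.
have -> : (n`! %/ occ_fact cf)%N = multinomial n a.
  by rewrite /multinomial /occ_fact; under eq_bigr do rewrite occ_cf.
have Dd : D = (\prod_j d j ^ a j)%N.
  case: rho_tensor => _ eq_D _ _; rewrite eq_D card_dep_ffun foldrE big_map big_enum /=.
  under eq_bigr do rewrite card_ord.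
  rewrite (partition_big c predT) //=; apply: eq_bigr => j _.
  rewrite (eq_bigr (fun=> d j)) => [|i /eqP-> //].
  by rewrite prod_nat_const -c_mult cardsE.
rewrite HS_eq; set F := \prod_j _; set Q := \prod_(j < k) _; set N := (_ ^ n)%:R.
have nzN : N != 0 by rewrite pnatr_eq0 expn_eq0 -leqn0 leqNgt n_gt0.
have Q_ge0 : 0 <= Q by apply: prodr_ge0 => j _; rewrite divr_ge0 ?mulr_ge0 ?ler0n.
(* In each block the factorials and [a j ^ a j] cancel, and [d j ^ a j] remains of the masses
   [d j * a j]. *)
have FQ : F * Q = D%:R.
  rewrite -big_split Dd natr_prod; apply: eq_bigr => j _ /=.
  rewrite /block_factor card_coef_block -!natrX expnMn natrM.
  have nz_fact m : (m`!)%:R != 0 :> C by rewrite pnatr_eq0 -lt0n fact_gt0.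
  (* For [a j = 0] this is the convention [0 ^ 0 = 1]. *)
  have nz_aa : (a j ^ a j)%:R != 0 :> C.
    by rewrite pnatr_eq0 expn_eq0; case: (a j).
  by field; rewrite nz_aa !nz_fact.
(* The bound is multiplied by [Q / N ^ 2]: the normalisation enters squared, and [Q] turns [F] into
   the dimension. *)
move=> leF; rewrite -FQ.
have -> : (multinomial n a)%:R * (N^-1 ^+ 2 * T cf) * (F * Q) =
  (multinomial n a)%:R * T cf * F * (N^-1 ^+ 2 * Q) by ring.
have -> : (n`!)%:R / N * Q = (n`! * n ^ n)%:R * (N^-1 ^+ 2 * Q).
  by rewrite natrM -/N; field.
by rewrite ler_wpM2r // mulr_ge0 // exprn_ge0 // invr_ge0 ler0n.
Qed.

(** A nonnegative complex number has imaginary part zero, so a bound for its real part suffices. *)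
Lemma complex_archi (R : realType) (x : R[i]) : 0 <= x -> exists m : nat, x <= m%:R.
Proof.
case: x => x y; rewrite lecE /= => /andP[/eqP-> x_ge0].
exists (Num.bound x); rewrite -(rmorph_nat (real_complex R)) lecR.
exact/ltW/archi_boundP.
Qed.

Theorem theorem6p1 (R : realType) (gT : finGroupType) (n : nat)
  (card_G : #|[set: gT]| = n)
  (k : nat) (d : 'I_k -> nat)
  (r : forall j : 'I_k, mx_representation R[i] [set: gT]%G (d j))
  (r_unitary : forall j, unitary_repr (r j))
  (r_irr : forall j, mx_irreducible (r j))
  (r_noniso : forall i j, i != j -> ~ mx_rsim (r i) (r j))
  (a : 'I_k -> nat) (sum_a : (\sum_(j < k) a j)%N = n)
  (D : nat) (rho : mx_representation R[i] [set: grp_pow gT n]%G D)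
  (rho_unitary : unitary_repr rho)
  (rho_irr : mx_irreducible rho)
  (c : 'I_n -> 'I_k)
  (c_mult : forall j, #|[set i | c i == j]| = a j)
  (rho_tensor : mx_rsim rho (tensor_repr (fun i => r (c i)))) :
  (multinomial n a)%:R * HS_norm (hat_1S rho) ^+ 2 * D%:R
    <= (n`!)%:R / (n ^ n)%:R *
       \prod_(j < k) (((a j + d j ^ 2 - 1)`!)%:R /
                      ((a j ^ a j)%:R * ((d j ^ 2 - 1)`!)%:R)).
Proof.
exact: (hat_1S_bound (@complex_archi R)) card_G sum_a r_unitary r_irr r_noniso
  c_mult rho_unitary rho_tensor.
Qed.
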